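(* Let $P$ be a rank-1 Hermitian projector-valued function on the extended complex plane $\overline{\mathbb{C}}$ which is a solution of the Euler-Lagrange equations $[\partial_+\partial_-P,P]=0$ with finite action $S(P)<\infty$, and let $F$ be the associated surface in $su(N)$. Then $F$ is conformally parameterized with conformal factor proportional to the Lagrangian density, i.e. there is a constant $c>0$ such that the first fundamental form of $F$ is $c\,L(P)\,(d\xi_1^2+d\xi_2^2)$, and the area of the surface is given by the action functional of the model, $A(F)=S(P)$. In particular, the surface has finite area.
   Context: Coordinates: $(\xi_1,\xi_2)\in\mathbb{R}^2$, $\xi_\pm=\xi_1\pm i\xi_2$, $\partial_\pm=\partial/\partial\xi_\pm=\frac12\left(\frac{\partial}{\partial \xi_1}\mp i\frac{\partial}{\partial\xi_2}\right)$. $\overline{\mathbb{C}}=\mathbb{C}\cup\{\infty\}$, with differentiability at $\infty$ meant in the coordinate $w_\pm=\xi_\pm^{-1}$. A rank-1 Hermitian projector (function) is an $N\times N$ complex matrix function $P$ of $(\xi_1,\xi_2)$ (sufficiently differentiable, not assumed holomorphic) with $P^2=P$, $P^\dagger=P$, $\mathrm{tr}(P)=1$ pointwise. Lagrangian density and action: $L(P)=\mathrm{tr}(\partial_+P\,\partial_-P)$, $S(P)=\int_{\mathbb{R}^2}L(P)\,d\xi_1d\xi_2$. Associated surface: since $P$ solves the Euler-Lagrange equations, the matrix one-form $$dF=i\left(-[\partial_+P,P]\,d\xi_++[\partial_-P,P]\,d\xi_-\right)$$ is closed and skew-Hermitian, and $F:\mathbb{R}^2\to su(N)$ is obtained by integrating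 it (it is determined up to an additive constant). The inner product on $su(N)$ is $(A,B)=-\frac12\mathrm{tr}(AB)$, and the first fundamental form (possibly degenerate where $L(P)=0$) and the area are those induced on $\mathbb{R}^2$ by $F$ from this inner product. *)

(* Defs.v *)
From HB Require Import structures.
From mathcomp Require Import all_boot all_order all_algebra.
From mathcomp Require Import complex.
From mathcomp Require Import all_classical all_reals all_analysis.

Set Implicit Arguments.
Unset Strict Implicit.
Unset Printing Implicit Defensive.

Import Order.TTheory GRing.Theory Num.Theory.
Import numFieldNormedType.Exports.

Local Open Scope ring_scope.
Local Open Scope complex_scope.
Local Open Scope sesquilinear_scope.
Local Open Scope classical_set_scope.

Fixpoint class_C (R : realType) (k : nat) (f : R * R -> R) : Prop :=
  match k with
  | 0 => continuous f
  | k'.+1 => (forall x, differentiable f x) /\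
             (forall v, class_C k' (fun x => 'D_v f x))
  end.

(* A matrix function of (xi1, xi2) is differentiated as a function of two real
   variables, through the real and imaginary parts of its entries. *)
Definition re_entry (R : realType) (N : nat) (A : R * R -> 'M[R[i]]_N)
  (i j : 'I_N) (x : R * R) : R := complex.Re (A x i j).

Definition im_entry (R : realType) (N : nat) (A : R * R -> 'M[R[i]]_N)
  (i j : 'I_N) (x : R * R) : R := complex.Im (A x i j).

Definition mx_class_C (R : realType) (N k : nat) (A : R * R -> 'M[R[i]]_N) :=
  forall i j, class_C k (re_entry A i j) /\ class_C k (im_entry A i j).

Definition mx_differentiable (R : realType) (N : nat)
    (A : R * R -> 'M[R[i]]_N) (x : R * R) : Prop :=
  forall i j, differentiable (re_entry A i j) x /\
              differentiable (im_entry A i j) x.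

(* The directional derivative of A at x along the real vector v. *)
Definition mx_derive (R : realType) (N : nat) (A : R * R -> 'M[R[i]]_N)
    (v x : R * R) : 'M[R[i]]_N :=
  \matrix_(i, j) ('D_v (re_entry A i j) x +i* 'D_v (im_entry A i j) x).

Definition d1 (R : realType) (N : nat) (A : R * R -> 'M[R[i]]_N) (x : R * R) :=
  mx_derive A (1, 0) x.

Definition d2 (R : realType) (N : nat) (A : R * R -> 'M[R[i]]_N) (x : R * R) :=
  mx_derive A (0, 1) x.

Definition dplus (R : realType) (N : nat) (A : R * R -> 'M[R[i]]_N)
    (x : R * R) : 'M[R[i]]_N :=
  2^-1 *: (d1 A x - 'i%C *: d2 A x).

Definition dminus (R : realType) (N : nat) (A : R * R -> 'M[R[i]]_N)
    (x : R * R) : 'M[R[i]]_N :=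
  2^-1 *: (d1 A x + 'i%C *: d2 A x).

Definition commutator (R : realType) (N : nat) (A B : 'M[R[i]]_N) : 'M[R[i]]_N :=
  A *m B - B *m A.

(* The extended complex plane: Some (xi1, xi2) is the finite point
   xi1 + i xi2 and None is the point at infinity. *)
Definition ext_plane (R : realType) : Type := one_point_compactification (R * R).

Definition chart_finite (R : realType) (x : R * R) : ext_plane R := Some x.

(* The parameterization of a neighbourhood of infinity by w = 1 / xi. *)
Definition chart_infty (R : realType) (w : R * R) : ext_plane R :=
  if w == 0 then None
  else let xi := (w.1 +i* w.2)^-1 in Some (complex.Re xi, complex.Im xi).

(* Twice continuously differentiable on the extended plane: the least
   regularity for which the Euler-Lagrange equations make sense. *)
Definition C2_ext_plane (R : realType) (N : nat)
    (P : ext_plane R -> 'M[R[i]]_N) : Prop :=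
  mx_class_C 2 (P \o @chart_finite R) /\ mx_class_C 2 (P \o @chart_infty R).

Definition rank1_projector (R : realType) (N : nat) (A : 'M[R[i]]_N) : Prop :=
  [/\ A *m A = A, A ^t* = A & \tr A = 1].

Definition euler_lagrange (R : realType) (N : nat)
    (A : R * R -> 'M[R[i]]_N) : Prop :=
  forall x, commutator (dplus (dminus A) x) (A x) = 0.

Definition lagrangian (R : realType) (N : nat) (A : R * R -> 'M[R[i]]_N)
    (x : R * R) : R[i] :=
  \tr (dplus A x *m dminus A x).

(* For Hermitian A the Lagrangian density is real and nonnegative, since
   dminus A is then the adjoint of dplus A; so Re only changes its type. *)
Definition action (R : realType) (N : nat) (A : R * R -> 'M[R[i]]_N) : \bar R :=
  (\int[(@lebesgue_measure R \x @lebesgue_measure R)]_(x in setT)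
    (complex.Re (lagrangian A x))%:E)%E.

Definition su (R : realType) (N : nat) (A : 'M[R[i]]_N) : Prop :=
  A ^t* = - A /\ \tr A = 0.

Definition su_inner (R : realType) (N : nat) (A B : 'M[R[i]]_N) : R[i] :=
  - 2^-1 * \tr (A *m B).

(* The value at x, on the tangent vector v, of the one-form
   i (- [dplus P, P] dxi_+ + [dminus P, P] dxi_-). *)
Definition surface_form (R : realType) (N : nat) (A : R * R -> 'M[R[i]]_N)
    (x v : R * R) : 'M[R[i]]_N :=
  'i%C *: (- ((v.1 +i* v.2) *: commutator (dplus A x) (A x))
         + (v.1 -i* v.2) *: commutator (dminus A x) (A x)).

(* F is a primitive of the one-form of A with values in su(N); such an F is
   unique up to an additive constant. *)
Definition associated_surface (R : realType) (N : nat)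
    (A F : R * R -> 'M[R[i]]_N) : Prop :=
  [/\ forall x, su (F x),
      forall x, mx_differentiable F x &
      forall x v, mx_derive F v x = surface_form A x v].

(* The matrix of the first fundamental form in the coordinates (xi1, xi2). *)
Definition first_fundamental_form (R : realType) (N : nat)
    (F : R * R -> 'M[R[i]]_N) (x : R * R) : 'M[R[i]]_2 :=
  let e (k : 'I_2) := if k == 0 then d1 F x else d2 F x in
  \matrix_(k, l) su_inner (e k) (e l).

(* The inner product is real on su(N), so Re only changes the type of the
   determinant. *)
Definition area (R : realType) (N : nat) (F : R * R -> 'M[R[i]]_N) : \bar R :=
  (\int[(@lebesgue_measure R \x @lebesgue_measure R)]_(x in setT)
    (Num.sqrt (complex.Re (\det (first_fundamental_form F x))))%:E)%E.

(* Main.v *)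
Require Import Defs.
From HB Require Import structures.
From mathcomp Require Import all_boot all_order all_algebra.
From mathcomp Require Import complex.
From mathcomp Require Import all_classical all_reals all_analysis.
From mathcomp Require Import ring lra.

Set Implicit Arguments.
Unset Strict Implicit.
Unset Printing Implicit Defensive.

Import Order.TTheory GRing.Theory Num.Theory.
Import numFieldNormedType.Exports.

Local Open Scope ring_scope.
Local Open Scope complex_scope.
Local Open Scope classical_set_scope.

(** Write P1 and P2 for the partial derivatives of the projector P. The
    one-form that defines the surface gives F1 = - [P2, P] and F2 = [P1, P].
    Since P1 and P2 are tangent at P, that is X P + P X = X, the bracket with
    P changes the form tr (X Y) by a sign only
    ([mxtrace_tangent_brackets]). Hence the matrix of the first fundamental
    form is half of

      tr (P2 P2)    - tr (P1 P2)
    - tr (P1 P2)      tr (P1 P1),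

    while L = (tr (P1 P1) + tr (P2 P2)) / 4. So F is conformal, with c = 1,
    as soon as tr (P1 P1) = tr (P2 P2) and tr (P1 P2) = 0. These traces are
    real, and the two equalities say together that the Hopf differential
    J = tr (dplus P dplus P) is zero.

    J vanishes because it is an entire function that tends to 0 at infinity.
    The Euler-Lagrange equations say that dminus (dplus P) commutes with P;
    it is then orthogonal to the tangent matrix dplus P, and this is the
    equation dminus J = 0 ([hopf_holomorphic]). The function P is regular at
    infinity in the coordinate 1 / xi, so its derivatives with respect to xi
    tend to 0 ([mx_derive_cvg0_at_infinity]).

    The real part u of such a function is zero for the following reason
    ([decaying_harmonic_eq0]): by the Cauchy-Riemann equations in polar
    coordinates, the radial derivative of u is 1 / r times the angular
    derivative of its conjugate, so the mean of u over a circle does not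
    depend on the radius. For a small radius the mean is close to the value
    of u at the centre, for a large one it is close to 0.

    The area integrand is the square root of det (L I) = L ^ 2, and L is
    nonnegative because the trace of the square of a hermitian matrix is. *)

(** * Partial derivatives and their symmetry *)

Section is_derive_elim.
Variables (R : realType) (V W : normedModType R).
Variables (f : V -> W) (x v : V) (df : W).

Lemma is_derive_val : is_derive x v f df -> 'D_v f x = df.
Proof. by case. Qed.

Lemma is_derive_derivable : is_derive x v f df -> derivable f x v.
Proof. by case. Qed.

End is_derive_elim.

Lemma is_derive_mulr (R : realType) (f g : R * R -> R) (x v : R * R) f' g' :
  is_derive x v f f' -> is_derive x v g g' ->
  is_derive x v (f * g) (f' * g x + f x * g').
Proof.
by move=> df dg; apply: is_derive_eq; rewrite /GRing.scale /= addrC [g x * _]mulrC.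
Qed.

Lemma derive_partials (R : realType) (f : R * R -> R) (x v : R * R) :
  differentiable f x ->
  'D_v f x = v.1 * 'D_(1, 0) f x + v.2 * 'D_(0, 1) f x.
Proof.
move=> df; rewrite !deriveE //.
have {1}-> : v = v.1 *: (1, 0) + v.2 *: (0, 1).
  case: v => a b; congr pair; rewrite /= /GRing.scale /= ?(mulr0, mulr1).
    by rewrite addr0.
  by rewrite add0r.
by rewrite [LHS]linearD !linearZ.
Qed.

Lemma is_derive_comp_pair (R : realType) (V : normedModType R)
    (f : R * R -> R) (a b : V -> R) (x v : V) :
  differentiable a x -> differentiable b x -> differentiable f (a x, b x) ->
  is_derive x v (fun y => f (a y, b y))
    ('D_v a x * 'D_(1, 0) f (a x, b x) + 'D_v b x * 'D_(0, 1) f (a x, b x)).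
Proof.
move=> da db df.
have dab : differentiable (fun y => (a y, b y)) x by exact: differentiable_pair.
have dfab : differentiable (f \o (fun y => (a y, b y))) x.
  exact: differentiable_comp.
apply: DeriveDef; first exact: diff_derivable.
rewrite (deriveE v dfab) diff_comp //= diff_pair //= -!deriveE //.
by rewrite derive_partials.
Qed.

Lemma is_derive_line (R : realType) (V : normedModType R) (f : V -> R)
    (p v : V) (s : R) :
  differentiable f (p + s *: v) ->
  is_derive s 1 (fun s => f (p + s *: v)) ('D_v f (p + s *: v)).
Proof.
move=> df.
have dl : is_diff s (cst p + ( *:%R^~ v)) ((0 : R -> V) + ( *:%R^~ v)) by exact: is_diffD.
have dfl : differentiable (f \o (cst p + ( *:%R^~ v))) s.
  by apply: differentiable_comp => //; exact: ex_diff.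
apply: DeriveDef; first exact: diff_derivable.
rewrite (deriveE _ dfl) diff_comp; [|exact: ex_diff|exact: df].
by rewrite [X in 'd f _ \o X]diff_val /= add0r scale1r deriveE.
Qed.

(** Two applications of the mean value theorem. The left-hand side does not
    change when v and w are exchanged, whence the symmetry of second
    derivatives below. *)
Lemma second_difference (R : realType) (V : normedModType R) (f : V -> R)
    (p v w : V) (h : R) : 0 < h ->
  (forall x, differentiable f x) -> (forall x, differentiable ('D_v f) x) ->
  exists s t, [/\ 0 < s < h, 0 < t < h &
    f (p + h *: v + h *: w) - f (p + h *: v) - f (p + h *: w) + f p =
    h ^+ 2 * 'D_w ('D_v f) (p + s *: v + t *: w)].
Proof.
move=> h0 df dvf.
(* The increment of f along w, as a function of the parameter along v. *)
pose phi s := f (p + h *: w + s *: v) - f (p + s *: v).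
pose dphi s := 'D_v f (p + h *: w + s *: v) - 'D_v f (p + s *: v).
have dphiE (s : R) : is_derive s 1 phi (dphi s).
  by apply: is_deriveB; exact: is_derive_line.
have [s /[!in_itv]/= sh] := MVT h0 (fun s _ => dphiE s)
   (derivable_within_continuous (fun s _ => is_derive_derivable (dphiE s))).
rewrite subr0 /phi scale0r !addr0 => phiE.
have psiE (t : R) : is_derive t 1 (fun t => 'D_v f (p + s *: v + t *: w))
   ('D_w ('D_v f) (p + s *: v + t *: w)) by exact: is_derive_line.
have [t /[!in_itv]/= th] := MVT h0 (fun t _ => psiE t)
   (derivable_within_continuous (fun t _ => is_derive_derivable (psiE t))).
rewrite subr0 scale0r addr0 => psi'E.
exists s, t; split => //.
rewrite addrAC in psi'E.
transitivity (dphi s * h); last by rewrite /dphi psi'E; ring.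
rewrite -phiE [p + h *: w + _]addrAC; ring.
Qed.

(** Both mixed derivatives are equal to the same second difference quotient at
    points arbitrarily close to p, and both are continuous at p. *)
Lemma derive_symmetric (R : realType) (V : normedModType R) (f : V -> R)
    (v w p : V) :
  (forall x, differentiable f x) ->
  (forall x, differentiable ('D_v f) x) ->
  (forall x, differentiable ('D_w f) x) ->
  {for p, continuous ('D_w ('D_v f))} -> {for p, continuous ('D_v ('D_w f))} ->
  'D_w ('D_v f) p = 'D_v ('D_w f) p.
Proof.
move=> df dvf dwf cwv cvw.
apply/eqP; rewrite -subr_eq0 -normr_le0; apply/ler_addgt0Pr => e e0.
rewrite add0r.
have e20 : 0 < e / 2 by rewrite divr_gt0.
have near_both (a b c : R) : `|a - c| < e / 2 -> `|b - c| < e / 2 -> `|a - b| <= e.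
  move=> ac; rewrite distrC => cb; rewrite (le_trans (ler_distD c _ _)) //.
  by rewrite [leRHS]splitr lerD // ltW.
have lim_line : (p + h.1 *: v + h.2 *: w) @[h --> (0 : R, 0 : R)] --> p.
  suff : (p + h.1 *: v + h.2 *: w) @[h --> (0 : R, 0 : R)] --> p + 0 *: v + 0 *: w.
    by rewrite !scale0r !addr0.
  apply: cvgD; [apply: cvgD; first exact: cvg_cst|]; apply: cvgZr_tmp.
    exact: cvg_fst.
  exact: cvg_snd.
have /cvgrPdist_lt/(_ _ e20) nwv : 'D_w ('D_v f) (p + h.1 *: v + h.2 *: w)
    @[h --> (0 : R, 0 : R)] --> 'D_w ('D_v f) p.
  exact: cvg_comp lim_line cwv.
have /cvgrPdist_lt/(_ _ e20) nvw : 'D_v ('D_w f) (p + h.1 *: v + h.2 *: w)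
    @[h --> (0 : R, 0 : R)] --> 'D_v ('D_w f) p.
  exact: cvg_comp lim_line cvw.
have nwvvw := @filterI _ _ (nbhs_filter (0 : R, 0 : R)) _ _ nwv nvw.
have [d /= d0 dH] := (nbhs_ballP _ _).1 nwvvw.
have h0 : 0 < d / 2 by rewrite divr_gt0.
have hd s : 0 < s < d / 2 -> `|s| < d.
  by move=> /andP[s0 sd]; rewrite gtr0_norm // (lt_trans sd) // gtr_pMr // invf_lt1 // ltr1n.
have [s [t [sh th E1]]] := second_difference p w h0 df dvf.
have [t' [s' [th' sh']]] := second_difference p v h0 df dwf.
rewrite (addrAC p (t' *: w)) => E2.
have E : 'D_w ('D_v f) (p + s *: v + t *: w) = 'D_v ('D_w f) (p + s' *: v + t' *: w).
  apply: (@mulfI _ ((d/2) ^+ 2)); first by rewrite expf_neq0 // gt_eqF.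
  apply: etrans (esym E1) (etrans _ E2).
  by rewrite (addrAC p ((d / 2) *: w)) (addrAC (f _)).
have inb (a b : R) : 0 < a < d / 2 -> 0 < b < d/2 -> ball (0 : R, 0 : R) d (a, b).
  by move=> /hd ha /hd hb; split; rewrite -ball_normE /ball_ /= sub0r normrN.
have [wv _] := dH _ (inb _ _ sh th); have [_ vw] := dH _ (inb _ _ sh' th').
rewrite /= E in wv.
exact: near_both wv vw.
Qed.

(** * Functions of class C^k *)

Section class_C_closure.
Variable R : realType.
Implicit Types f g : R * R -> R.

Lemma class_CW k f : class_C k.+1 f -> class_C k f.
Proof.
elim: k f => [f [df _] x|k IH f [df Df]].
  exact: differentiable_continuous.
by split=> // v; apply: IH.
Qed.

Lemma class_C_cst k (a : R) : class_C k (fun=> a).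
Proof.
elim: k a => [a|k IH a]; first exact: cst_continuous.
split=> [x|v]; first exact: differentiable_cst.
have -> : 'D_v (fun=> a) = (fun=> 0 : R) by apply/funext => x; exact: derive_cst.
exact: IH.
Qed.

Lemma class_CD k f g : class_C k f -> class_C k g -> class_C k (f + g).
Proof.
elim: k f g => [f g cf cg x|k IH f g [df Df] [dg Dg]].
  by apply: cvgD; [exact: cf|exact: cg].
split=> [x|v]; first exact: differentiableD.
have -> : 'D_v (f + g) = 'D_v f + 'D_v g.
  by apply/funext => x; apply: deriveD; exact: diff_derivable.
by apply: IH; [exact: Df|exact: Dg].
Qed.

Lemma class_CM k f g : class_C k f -> class_C k g -> class_C k (f * g).
Proof.
elim: k f g => [f g cf cg x|k IH f g Cf Cg].
  by apply: cvgM; [exact: cf|exact: cg].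
have [df Df] := Cf; have [dg Dg] := Cg.
split=> [x|v]; first exact: differentiableM.
have -> : 'D_v (f * g) = f * 'D_v g + g * 'D_v f.
  by apply/funext => x; apply: deriveM; exact: diff_derivable.
by apply: class_CD; apply: IH; do [exact: class_CW|exact: Dg|exact: Df].
Qed.

Lemma class_CZ k (c : R) f : class_C k f -> class_C k (c *: f).
Proof. by move=> Cf; apply: (class_CM (class_C_cst k c)). Qed.

End class_C_closure.

(** * Conjugate harmonic functions that decay at infinity *)

(** The neighbourhoods of infinity in the plane, without infinity itself.
    The conditions are on the squared Euclidean norm, as the circles below
    are Euclidean. *)
Definition at_infinity (R : realType) : set_system (R * R) :=
  [set A | exists M, forall x, M < x.1 ^+ 2 + x.2 ^+ 2 -> A x].

#[global] Instance at_infinity_filter (R : realType) : Filter (@at_infinity R).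
Proof.
split; first by exists 0.
- move=> A B [M AM] [N BN]; exists (Num.max M N) => x.
  by rewrite gt_max => /andP[/AM ? /BN].
- by move=> A B AB [M AM]; exists M => x /AM; exact: AB.
Qed.

Lemma cvg_comp_pair (R : realType) (T : Type) (G : set_system T)
    (FG : Filter G) (f : R * R -> R) (a b : T -> R) (x y : R) :
  {for (x, y), continuous f} -> a @ G --> x -> b @ G --> y ->
  f (a t, b t) @[t --> G] --> f (x, y).
Proof.
move=> cf ax bx.
exact: (cvg_comp (fun t => (a t, b t)) f (cvg_pair ax bx) cf).
Qed.

(** ** Mean value property on circles *)

Section circle_mean.
Variables (R : realType) (u v : R * R -> R).
Hypotheses (Cu : class_C 1 u) (Cv : class_C 1 v).
Hypothesis CR1 : forall x, 'D_(1, 0) u x = 'D_(0, 1) v x.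
Hypothesis CR2 : forall x, 'D_(0, 1) u x = - 'D_(1, 0) v x.
Variable z : R * R.

Let mu := @lebesgue_measure R.
Let circle (f : R * R -> R) r t := f (z.1 + r * cos t, z.2 + r * sin t).
Let radial r t := cos t * circle ('D_(1, 0) u) r t + sin t * circle ('D_(0, 1) u) r t.
Let turn : set R := `[0, pi *+ 2].

Let continuous_circle f : continuous f ->
  continuous (fun p => circle f p.1 p.2).
Proof.
move=> cf p; apply: cvg_comp_pair; first exact: cf.
  apply: cvgD; first exact: cvg_cst.
  apply: cvgM; first exact: cvg_fst.
  by apply: continuous_comp; [exact: cvg_snd|exact: continuous_cos].
apply: cvgD; first exact: cvg_cst.
apply: cvgM; first exact: cvg_fst.
by apply: continuous_comp; [exact: cvg_snd|exact: continuous_sin].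
Qed.

Let continuous_radial : continuous (fun p => radial p.1 p.2).
Proof.
have [_ cDu] := Cu.
move=> p; apply: cvgD; apply: cvgM; try (apply: continuous_circle; exact: cDu).
  by apply: continuous_comp; [exact: cvg_snd|exact: continuous_cos].
by apply: continuous_comp; [exact: cvg_snd|exact: continuous_sin].
Qed.

Let continuous_slice (g : R * R -> R) r : continuous g ->
  continuous (fun t => g (r, t)).
Proof.
by move=> cg t; apply: cvg_comp_pair; [exact: cg|exact: cvg_cst|exact: cvg_id].
Qed.

Let integrable_slice (g : R * R -> R) r : continuous g ->
  mu.-integrable turn (EFin \o (fun t => g (r, t))).
Proof.
move=> cg; apply: continuous_compact_integrable; first exact: segment_compact.
exact/continuous_subspaceT/continuous_slice.
Qed.

Let radial_derive (r t : R) : is_derive r 1 (circle u ^~ t) (radial r t).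
Proof.
have [du _] := Cu.
have da : is_derive r 1 (fun r => z.1 + r * cos t) (cos t).
  by apply: is_derive_eq; rewrite /GRing.scale /=; ring.
have db : is_derive r 1 (fun r => z.2 + r * sin t) (sin t).
  by apply: is_derive_eq; rewrite /GRing.scale /=; ring.
apply: is_derive_eq; first apply: is_derive_comp_pair => //; try exact/derivable1_diffP.
by rewrite !derive_val.
Qed.

(* The Cauchy-Riemann equations in polar coordinates. *)
Let angular_derive (r t : R) : is_derive t 1 (circle v r) (r * radial r t).
Proof.
have [dv _] := Cv.
have da : is_derive t 1 (fun t => z.1 + r * cos t) (- r * sin t).
  by apply: is_derive_eq; rewrite /GRing.scale /=; ring.
have db : is_derive t 1 (fun t => z.2 + r * sin t) (r * cos t).
  by apply: is_derive_eq; rewrite /GRing.scale /=; ring.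
apply: is_derive_eq; first apply: is_derive_comp_pair => //; try exact/derivable1_diffP.
rewrite !derive_val /radial /circle CR1 CR2; ring.
Qed.

(* Up to the factor r, the radial derivative of u is the angular derivative of
   v, whose integral over a full turn is zero. *)
Let radial_mean (r : R) : r != 0 -> \int[mu]_(t in turn) radial r t = 0.
Proof.
move=> r0; have cr := @continuous_slice _ r continuous_radial.
have cV t : {for t, continuous (circle v r)}.
  apply/differentiable_continuous/derivable1_diffP; exact: ex_derive.
apply: (mulfI r0); rewrite mulr0 -RintegralZl; first last.
- exact: (@integrable_slice _ r continuous_radial).
- exact: measurable_itv.
rewrite /Rintegral /mu /turn (@continuous_FTC2 _ _ (circle v r)).
- by rewrite /circle cos2pi sin2pi cos0 sin0 -EFinB subrr.
- by rewrite mulrn_wgt0 // pi_gt0.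
- apply: continuous_subspaceT => t; apply: cvgM; first exact: cvg_cst.
  exact: cr.
- split=> [t _| |].
  + exact: (is_derive_derivable (angular_derive r t)).
  + apply: cvg_at_right_filter; exact: cV.
  + apply: cvg_at_left_filter; exact: cV.
- by move=> t _; rewrite derive1E (is_derive_val (angular_derive r t)).
Qed.

Let mean (r : R) := \int[mu]_(t in turn) circle u r t.

Let mean_derive (r : R) : is_derive r 1 mean (\int[mu]_(t in turn) radial r t).
Proof.
(* A constant bound dominates the radial derivative, which is continuous on a
   compact rectangle. *)
have [M Mub] : exists M : R, forall p, (`[r - 1, r + 1] `*` turn) p ->
    `|radial p.1 p.2| <= M.
  have cK : compact (`[r - 1, r + 1] `*` turn).
    by apply: compact_setX; exact: segment_compact.
  have : compact ((fun p => radial p.1 p.2) @` (`[r - 1, r + 1] `*` turn)).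
    apply: continuous_compact => //; exact: continuous_subspaceT.
  move=> /compact_bounded[M [_ MH]]; exists (M + 1) => p Kp.
  by apply: (MH (M + 1)); [rewrite ltrDl|exists p].
have M_ge0 : (0 : R) <= M.
  apply: le_trans (normr_ge0 _) (Mub (r, 0) _).
  split; rewrite /turn /= in_itv.
    by rewrite /= lerBlDr lerDl ler01.
  by rewrite /= lexx mulrn_wge0 // pi_ge0.
have ri : `]r - 1, r + 1[%classic r by rewrite /= in_itv /= ltrBlDr ltrDl ltr01.
have intu s : `]r - 1, r + 1[%classic s -> mu.-integrable turn (EFin \o circle u s).
  by move=> _; apply: (@integrable_slice _ s (continuous_circle (class_CW Cu))).
have du s t : `]r - 1, r + 1[%classic s -> turn t -> derivable (circle u ^~ t) s 1.
  by move=> _ _; exact: (is_derive_derivable (radial_derive s t)).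
have intM : mu.-integrable turn (EFin \o cst M).
  apply: continuous_compact_integrable; first exact: segment_compact.
  exact/continuous_subspaceT/cst_continuous.
have ub s t : `]r - 1, r + 1[%classic s -> turn t ->
    `|partial1of2 (circle u) s t| <= M.
  move=> Is tt; rewrite partial1of2E (is_derive_val (radial_derive s t)).
  by apply: (Mub (s, t)); split => //=; exact: subset_itv_oo_cc.
have dm := @derivable_under_integral R _ _ mu (circle u) turn
  (measurable_itv _) _ _ _ ri intu du (fun=> M) (fun=> M_ge0) intM ub.
have := @differentiation_under_integral R _ _ mu (circle u) turn
  (measurable_itv _) _ _ _ ri intu du (fun=> M) (fun=> M_ge0) intM ub.
rewrite (_ : \int[mu]_(t in turn) _ = \int[mu]_(t in turn) radial r t); last first.
  apply: eq_Rintegral => t _.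
  by rewrite partial1of2E (is_derive_val (radial_derive r t)).
by rewrite derive1E => dmE; apply: DeriveDef.
Qed.

(** The mean over the circle of radius r has derivative zero for r > 0, so it
    is equal to its value at r = 0. *)
Lemma circle_mean_value (r : R) : 0 < r ->
  \int[mu]_(t in turn) circle u r t = pi *+ 2 * u z.
Proof.
move=> r0.
have cmean0 : mean 0 = pi *+ 2 * u z.
  rewrite /mean /circle; under eq_Rintegral do rewrite !mul0r !addr0.
  rewrite Rintegral_cst /=; last exact: measurable_itv.
  rewrite lebesgue_measure_itv /= lte_fin mulrn_wgt0 ?pi_gt0 //= oppr0 addr0.
  by rewrite -surjective_pairing mulrC.
rewrite -cmean0 -/(mean r); apply/eqP; rewrite -subr_eq0.
have [c] := MVT r0 (fun x _ => mean_derive x)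
   (derivable_within_continuous (fun x _ => is_derive_derivable (mean_derive x))).
by rewrite in_itv /= => /andP[/gt_eqF/negbT c0 _] ->; rewrite radial_mean // mul0r.
Qed.
End circle_mean.

(** The value at z is the mean of u over arbitrarily large circles around z. *)
Lemma decaying_harmonic_eq0 (R : realType) (u v : R * R -> R) :
  class_C 1 u -> class_C 1 v ->
  (forall x, 'D_(1, 0) u x = 'D_(0, 1) v x) ->
  (forall x, 'D_(0, 1) u x = - 'D_(1, 0) v x) ->
  u @ @at_infinity R --> 0 -> forall z, u z = 0.
Proof.
move=> Cu Cv CR1 CR2 u0 z; apply/eqP; rewrite -normr_le0.
apply/ler_addgt0Pr => e e0; rewrite add0r.
have /cvgr0_norm_le/(_ _ e0)[M uM] := u0.
(* The squared norm of a point of the circle of radius r around z is at least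
   r * (r - 2 * s), and this radius makes r - 2 * s equal to 1 + `|M|. *)
pose s := `|z.1| + `|z.2|; pose r := 2 * s + (1 + `|M|).
have s0 : 0 <= s by rewrite addr_ge0.
have rM : 1 <= 1 + `|M| by rewrite lerDl.
have r1 : 1 <= r by rewrite (le_trans rM) // lerDr mulr_ge0.
have r0 : 0 < r by rewrite (lt_le_trans ltr01).
have far t : M < (z.1 + r * cos t) ^+ 2 + (z.2 + r * sin t) ^+ 2.
  have cross : - s <= z.1 * cos t + z.2 * sin t.
    rewrite lerNl opprD lerD // -mulNr (le_trans (ler_norm _)) //.
      by rewrite normrM normrN ler_piMr // ler_norml cos_geN1 cos_le1.
    by rewrite normrM normrN ler_piMr // ler_norml sin_geN1 sin_le1.
  have -> : (z.1 + r * cos t) ^+ 2 + (z.2 + r * sin t) ^+ 2 =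
     z.1 ^+ 2 + z.2 ^+ 2 + r * (r + 2 * (z.1 * cos t + z.2 * sin t)).
    apply: subr0_eq; transitivity (r ^+ 2 * (cos t ^+ 2 + sin t ^+ 2 - 1)).
      by ring.
    by rewrite cos2Dsin2 subrr mulr0.
  have bnd : 1 + `|M| <= r + 2 * (z.1 * cos t + z.2 * sin t).
    by rewrite /r; lra.
  apply: (le_lt_trans (ler_norm M)).
  apply: (@lt_le_trans _ _ (1 + `|M|)); first by rewrite ltrDr.
  rewrite (le_trans bnd) // -[leLHS]add0r lerD ?addr_ge0 ?sqr_ge0 //.
  by rewrite ler_peMl // (le_trans _ bnd) // addr_ge0.
have := circle_mean_value Cu Cv CR1 CR2 z r0.
set I := Rintegral _ _ _ => IE.
have cont : continuous (fun t => u (z.1 + r * cos t, z.2 + r * sin t)).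
  move=> t; apply: cvg_comp_pair; first exact: (class_CW Cu).
    apply: cvgD; first exact: cvg_cst.
    by apply: cvgM; [exact: cvg_cst|exact: continuous_cos].
  apply: cvgD; first exact: cvg_cst.
  by apply: cvgM; [exact: cvg_cst|exact: continuous_sin].
have int_cont (f : R -> R) : continuous f ->
    lebesgue_measure.-integrable `[0, pi *+ 2] (EFin \o f).
  move=> cf; apply: continuous_compact_integrable; first exact: segment_compact.
  exact: continuous_subspaceT.
have : `|I| <= pi *+ 2 * e.
  have le_I := le_normr_Rintegral _ (int_cont _ cont).
  apply: le_trans (le_I _) _; first exact: measurable_itv.
  have -> : pi *+ 2 * e = \int[lebesgue_measure]_(t in `[0, pi *+ 2]) e.
    rewrite Rintegral_cst /=; last exact: measurable_itv.
    rewrite lebesgue_measure_itv /= lte_fin mulrn_wgt0 ?pi_gt0 //= oppr0 addr0.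
    by rewrite mulrC.
  apply: le_Rintegral; first exact: measurable_itv.
  - by apply: int_cont => t; apply: continuous_comp; [exact: cont|exact: norm_continuous].
  - exact/int_cont/cst_continuous.
  - by move=> t _; exact: (uM (_, _) (far t)).
have tau0 : 0 < pi *+ 2 :> R by rewrite mulrn_wgt0 // pi_gt0.
by rewrite IE normrM (gtr0_norm tau0) ler_pM2l.
Qed.

(** Liouville's theorem for an entire function u + iv that tends to 0 at
    infinity: the pair (v, - u) satisfies the same equations as (u, v). *)
Lemma decaying_cauchy_riemann_eq0 (R : realType) (u v : R * R -> R) :
  class_C 1 u -> class_C 1 v ->
  (forall x, 'D_(1, 0) u x = 'D_(0, 1) v x) ->
  (forall x, 'D_(0, 1) u x = - 'D_(1, 0) v x) ->
  u @ @at_infinity R --> 0 -> v @ @at_infinity R --> 0 ->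
  forall z, u z +i* v z = 0.
Proof.
move=> Cu Cv CR1 CR2 u0 v0 z.
have du x w : 'D_w (- u) x = - 'D_w u x.
  by rewrite deriveN //; apply: diff_derivable; case: Cu.
have CNu : class_C 1 (- u) by rewrite -scaleN1r; exact: class_CZ.
rewrite (decaying_harmonic_eq0 Cu Cv CR1 CR2 u0).
rewrite (decaying_harmonic_eq0 Cv CNu _ _ v0) // => x.
  by rewrite du CR2 opprK.
by rewrite du opprK CR1.
Qed.

(** * Decay through the inversion of the plane *)

Section inversion.
Variable R : realType.
Implicit Types x v : R * R.

Lemma differentiable_fst x : differentiable (fst : R * R -> R) x.
Proof. by apply: linear_differentiable => y; exact: cvg_fst. Qed.

Lemma differentiable_snd x : differentiable (snd : R * R -> R) x.
Proof. by apply: linear_differentiable => y; exact: cvg_snd. Qed.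

Lemma is_derive_fst x v : is_derive x v (fst : R * R -> R) v.1.
Proof.
apply: DeriveDef; first exact/diff_derivable/differentiable_fst.
by rewrite deriveE ?diff_lin // => [y|]; [exact: cvg_fst|exact: differentiable_fst].
Qed.

Lemma is_derive_snd x v : is_derive x v (snd : R * R -> R) v.2.
Proof.
apply: DeriveDef; first exact/diff_derivable/differentiable_snd.
by rewrite deriveE ?diff_lin // => [y|]; [exact: cvg_snd|exact: differentiable_snd].
Qed.

Definition sqnorm x : R := x.1 ^+ 2 + x.2 ^+ 2.
(** The two real coordinates of 1 / (x1 + i x2). *)
Definition inversion1 x := x.1 / sqnorm x.
Definition inversion2 x := - x.2 / sqnorm x.

Lemma differentiable_sqnorm x : differentiable sqnorm x.
Proof.
apply: (@differentiableD _ _ _ (fst ^+ 2 : R * R -> R) (snd ^+ 2 : R * R -> R)).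
  exact/differentiableX/differentiable_fst.
exact/differentiableX/differentiable_snd.
Qed.

Lemma is_derive_sqnorm x v :
  is_derive x v sqnorm (2 * (x.1 * v.1 + x.2 * v.2)).
Proof.
have dx := is_derive_fst x v; have dy := is_derive_snd x v.
have := is_deriveD (is_deriveM dx dx) (is_deriveM dy dy).
by move=> /is_derive_eq; apply; rewrite /GRing.scale /=; ring.
Qed.

Lemma is_derive_inv_sqnorm x v : sqnorm x != 0 ->
  is_derive x v (fun y => (sqnorm y)^-1)
    (- (sqnorm x) ^- 2 * (2 * (x.1 * v.1 + x.2 * v.2))).
Proof.
move=> n0; have dn := is_derive_sqnorm x v.
apply: DeriveDef; first by apply: derivableV => //; exact: ex_derive.
by rewrite deriveV // ?derive_val //; exact: ex_derive.
Qed.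

Lemma differentiable_inversion1 x : sqnorm x != 0 -> differentiable inversion1 x.
Proof.
move=> n0; apply: (@differentiableM _ _ fst (fun y => (sqnorm y)^-1)).
  exact: differentiable_fst.
by apply: differentiableV => //; exact: differentiable_sqnorm.
Qed.

Lemma differentiable_inversion2 x : sqnorm x != 0 -> differentiable inversion2 x.
Proof.
move=> n0; apply: (@differentiableM _ _ (- snd) (fun y => (sqnorm y)^-1)).
  exact/differentiableN/differentiable_snd.
by apply: differentiableV => //; exact: differentiable_sqnorm.
Qed.

(** Written as a polynomial in quantities that tend to 0 at infinity; the same
    for the second coordinate. *)
Lemma derive_inversion1 x v : sqnorm x != 0 ->
  'D_v inversion1 x = v.1 * (sqnorm x)^-1
    - 2 * inversion1 x * (inversion1 x * v.1 - inversion2 x * v.2).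
Proof.
move=> n0; have dx := is_derive_fst x v; have dn := is_derive_inv_sqnorm v n0.
rewrite (is_derive_val (is_deriveM dx dn)) /inversion1 /inversion2.
have alg (n a b c d : R) : n != 0 -> a * (- n ^- 2 * (2 * (a * c + b * d))) + n^-1 * c =
    c / n - 2 * (a / n) * (a / n * c - - b / n * d) by move=> ?; field.
exact: alg.
Qed.

Lemma derive_inversion2 x v : sqnorm x != 0 ->
  'D_v inversion2 x = - v.2 * (sqnorm x)^-1
    - 2 * inversion2 x * (inversion1 x * v.1 - inversion2 x * v.2).
Proof.
move=> n0; have dy := is_derive_snd x v; have dn := is_derive_inv_sqnorm v n0.
rewrite (is_derive_val (is_deriveM (is_deriveN dy) dn)) /inversion1 /inversion2.
have alg (n a b c d : R) : n != 0 -> - b * (- n ^- 2 * (2 * (a * c + b * d))) + n^-1 * - d =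
    - d / n - 2 * (- b / n) * (a / n * c - - b / n * d) by move=> ?; field.
exact: alg.
Qed.

Lemma inv_sqnorm_cvg0 : (sqnorm x)^-1 @[x --> @at_infinity R] --> 0.
Proof.
apply/cvgr0Pnorm_lt => e e0; exists e^-1 => x xe.
have x0 : 0 < sqnorm x by rewrite (lt_trans _ xe) // invr_gt0.
by rewrite gtr0_norm ?invr_gt0 // invf_plt ?posrE.
Qed.

Let cvg0_of_sqr (f : R * R -> R) :
  (forall x, f x ^+ 2 <= (sqnorm x)^-1) -> f @ @at_infinity R --> 0.
Proof.
move=> fn; apply/cvgr0Pnorm_lt => e e0.
have := inv_sqnorm_cvg0 => /cvgr0Pnorm_lt/(_ _ (exprn_gt0 2 e0)).
apply: filterS => x xe.
rewrite -(@ltr_pXn2r _ 2) ?nnegrE ?(ltW e0) //.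
by rewrite real_normK ?num_real // (le_lt_trans (fn x)) // (le_lt_trans (ler_norm _)).
Qed.

Lemma inversion1_cvg0 : inversion1 @ @at_infinity R --> 0.
Proof.
apply: cvg0_of_sqr => x; rewrite /inversion1.
have [->|n0] := eqVneq (sqnorm x) 0; first by rewrite invr0 mulr0 expr0n.
have n_gt0 : 0 < sqnorm x by rewrite lt_def n0 addr_ge0 ?sqr_ge0.
rewrite expr_div_n ler_pdivrMr ?exprn_gt0 // expr2 [_ ^+ 2]expr2 mulKf //.
by rewrite lerDl sqr_ge0.
Qed.

Lemma inversion2_cvg0 : inversion2 @ @at_infinity R --> 0.
Proof.
apply: cvg0_of_sqr => x; rewrite /inversion2.
have [->|n0] := eqVneq (sqnorm x) 0; first by rewrite invr0 mulr0 expr0n.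
have n_gt0 : 0 < sqnorm x by rewrite lt_def n0 addr_ge0 ?sqr_ge0.
rewrite expr_div_n sqrrN ler_pdivrMr ?exprn_gt0 // [sqnorm x ^+ 2]expr2 mulKf //.
by rewrite lerDr sqr_ge0.
Qed.

Let derive_inversion_cvg0 (f : R * R -> R) (c : R) v :
  f @ @at_infinity R --> 0 ->
  c * (sqnorm x)^-1 - 2 * f x * (inversion1 x * v.1 - inversion2 x * v.2)
    @[x --> @at_infinity R] --> 0.
Proof.
move=> f0.
rewrite [X in _ --> X](_ : 0 = c * 0 - 2 * 0 * (0 * v.1 - 0 * v.2)); last by ring.
apply: cvgB; first by apply: cvgM; [exact: cvg_cst|exact: inv_sqnorm_cvg0].
apply: cvgM; first by apply: cvgM; [exact: cvg_cst|exact: f0].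
apply: cvgB; apply: cvgM; try exact: cvg_cst; first exact: inversion1_cvg0.
exact: inversion2_cvg0.
Qed.

Lemma derive_inversion1_cvg0 v : 'D_v inversion1 x @[x --> @at_infinity R] --> 0.
Proof.
apply: cvg_trans (derive_inversion_cvg0 v.1 v inversion1_cvg0).
apply: near_eq_cvg; exists 0 => x n_gt0.
by rewrite derive_inversion1 // gt_eqF.
Qed.

Lemma derive_inversion2_cvg0 v : 'D_v inversion2 x @[x --> @at_infinity R] --> 0.
Proof.
apply: cvg_trans (derive_inversion_cvg0 (- v.2) v inversion2_cvg0).
apply: near_eq_cvg; exists 0 => x n_gt0.
by rewrite derive_inversion2 // gt_eqF.
Qed.

(** By the chain rule: the derivatives of q are bounded near 0 and those of the
    inversion tend to 0 at infinity. *)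
Lemma derive_cvg0_at_infinity (f q : R * R -> R) v : class_C 1 q ->
  (forall x, sqnorm x != 0 -> f x = q (inversion1 x, inversion2 x)) ->
  'D_v f x @[x --> @at_infinity R] --> 0.
Proof.
move=> [dq Dq] fq.
have far x : 0 < sqnorm x -> 'D_v f x =
   'D_v inversion1 x * 'D_(1, 0) q (inversion1 x, inversion2 x) +
   'D_v inversion2 x * 'D_(0, 1) q (inversion1 x, inversion2 x).
  move=> n_gt0; have n0 : sqnorm x != 0 by rewrite gt_eqF.
  have dq' := is_derive_comp_pair v (differentiable_inversion1 n0)
    (differentiable_inversion2 n0) (dq _).
  rewrite -(is_derive_val dq'); apply: near_eq_derive.
  have /cvgr_neq0 := differentiable_continuous (differentiable_sqnorm x).
  by move=> /(_ n0); apply: filterS => y; exact: fq.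
have lim : ('D_v inversion1 x * 'D_(1, 0) q (inversion1 x, inversion2 x) +
   'D_v inversion2 x * 'D_(0, 1) q (inversion1 x, inversion2 x))
    @[x --> @at_infinity R] --> 0.
  rewrite [X in _ --> X](_ : 0 = 0 * 'D_(1, 0) q (0, 0) + 0 * 'D_(0, 1) q (0, 0));
    last by rewrite !mul0r addr0.
  have Dq0 w : 'D_w q (inversion1 x, inversion2 x) @[x --> @at_infinity R]
      --> 'D_w q (0, 0).
    exact: (cvg_comp_pair _ (Dq w (0, 0)) inversion1_cvg0 inversion2_cvg0).
  exact: (cvgD (cvgM (derive_inversion1_cvg0 v) (Dq0 _))
               (cvgM (derive_inversion2_cvg0 v) (Dq0 _))).
by apply: cvg_trans lim; apply: near_eq_cvg; exists 0 => x /far.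
Qed.
End inversion.

(** * Tangent matrices at a projector *)

Section projector_algebra.
Variables (C : comPzRingType) (N : nat) (P : 'M[C]_N).
Implicit Types X Y D : 'M[C]_N.
Hypothesis PP : P *m P = P.

(** The condition X P + P X = X holds for the derivatives X of a projector P:
    differentiate P P = P. It says that X has no diagonal block for the
    splitting of the space into the image and the kernel of P. *)
Lemma tangent_off_diagonal X : X *m P + P *m X = X -> P *m X *m P = 0.
Proof.
move=> tX; have : P *m (X *m P + P *m X) *m P = P *m X *m P by rewrite tX.
rewrite mulmxDr mulmxDl !mulmxA PP -!mulmxA PP.
by move/(congr1 (fun M => M - P *m (X *m P))); rewrite addrK subrr.
Qed.

(** A matrix that commutes with P is block diagonal, and the product of a block
    diagonal and a block off-diagonal matrix has trace zero. *)
Lemma mxtrace_commuting_tangent D X :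
  D *m P = P *m D -> X *m P + P *m X = X -> \tr (D *m X) = 0.
Proof.
move=> DP tX; have XP := tangent_off_diagonal tX.
have DX : \tr (D *m (X *m P)) = 0.
  have -> : \tr (D *m (X *m P)) = \tr (D *m (P *m X *m P)).
    rewrite -[in LHS]PP [in LHS]mulmxA mulmxA mxtrace_mulC !mulmxA -DP.
    by rewrite -!mulmxA.
  by rewrite XP mulmx0 mxtrace0.
have DX' : \tr (D *m (P *m X)) = 0.
  by rewrite mulmxA DP -mulmxA mxtrace_mulC -mulmxA.
by rewrite -tX mulmxDr mxtraceD DX DX' addr0.
Qed.

(** The bracket with P multiplies the two off-diagonal blocks by 1 and -1, so
    that it changes the trace form on tangent matrices by a sign. *)
Lemma mxtrace_tangent_brackets X Y :
  X *m P + P *m X = X -> Y *m P + P *m Y = Y ->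
  \tr ((X *m P - P *m X) *m (Y *m P - P *m Y)) = - \tr (X *m Y).
Proof.
move=> tX tY; have XP := tangent_off_diagonal tX; have YP := tangent_off_diagonal tY.
rewrite mulmxBl !mulmxBr !raddfB /= -[in RHS]tX mulmxDl mxtraceD.
have -> : \tr (X *m P *m (Y *m P)) = 0.
  by rewrite -!mulmxA (mulmxA P) YP mulmx0 mxtrace0.
have -> : \tr (P *m X *m (P *m Y)) = 0.
  by rewrite mulmxA XP mul0mx mxtrace0.
have -> : X *m P *m (P *m Y) = X *m P *m Y by rewrite -!mulmxA (mulmxA P P) PP.
have -> : \tr (P *m X *m (Y *m P)) = \tr (P *m X *m Y).
  by rewrite -!mulmxA mxtrace_mulC -!mulmxA PP mxtrace_mulC -!mulmxA mxtrace_mulC mulmxA.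
ring.
Qed.
End projector_algebra.

(** * Calculus of matrix functions of two real variables *)

Section complex_parts.
Variable R : realType.
Implicit Types z w : R[i].

Lemma ReD z w : complex.Re (z + w) = complex.Re z + complex.Re w.
Proof. by case: z w => a b [c d]. Qed.

Lemma ImD z w : complex.Im (z + w) = complex.Im z + complex.Im w.
Proof. by case: z w => a b [c d]. Qed.

Lemma ReM z w : complex.Re (z * w) =
  complex.Re z * complex.Re w - complex.Im z * complex.Im w.
Proof. by case: z w => a b [c d]. Qed.

Lemma ImM z w : complex.Im (z * w) =
  complex.Re z * complex.Im w + complex.Im z * complex.Re w.
Proof. by case: z w => a b [c d]. Qed.

Lemma Re_sum (I : Type) (r : seq I) (F : I -> R[i]) :
  complex.Re (\sum_(i <- r) F i) = \sum_(i <- r) complex.Re (F i).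
Proof. exact: (big_morph _ ReD). Qed.

Lemma Im_sum (I : Type) (r : seq I) (F : I -> R[i]) :
  complex.Im (\sum_(i <- r) F i) = \sum_(i <- r) complex.Im (F i).
Proof. exact: (big_morph _ ImD). Qed.

Lemma conjCE z : Num.conj z = z^*.
Proof. by []. Qed.
End complex_parts.

Section entries.
Variables (R : realType) (N : nat) (A B : R * R -> 'M[R[i]]_N) (i j : 'I_N).

Lemma re_entryD :
  re_entry (fun y => A y + B y) i j = re_entry A i j + re_entry B i j.
Proof. by apply/funext => y; rewrite /re_entry mxE ReD. Qed.

Lemma im_entryD :
  im_entry (fun y => A y + B y) i j = im_entry A i j + im_entry B i j.
Proof. by apply/funext => y; rewrite /im_entry mxE ImD. Qed.

Lemma re_entryZ (c : R[i]) : re_entry (fun y => c *: A y) i j =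
  complex.Re c *: re_entry A i j - complex.Im c *: im_entry A i j.
Proof. by apply/funext => y; rewrite /re_entry mxE ReM. Qed.

Lemma im_entryZ (c : R[i]) : im_entry (fun y => c *: A y) i j =
  complex.Re c *: im_entry A i j + complex.Im c *: re_entry A i j.
Proof. by apply/funext => y; rewrite /im_entry mxE ImM. Qed.

Lemma re_entry_derive (v : R * R) :
  re_entry (mx_derive A v) i j = 'D_v (re_entry A i j).
Proof. by apply/funext => y; rewrite /re_entry mxE. Qed.

Lemma im_entry_derive (v : R * R) :
  im_entry (mx_derive A v) i j = 'D_v (im_entry A i j).
Proof. by apply/funext => y; rewrite /im_entry mxE. Qed.

Lemma re_entryM : re_entry (fun y => A y *m B y) i j =
  \sum_(k < N) (re_entry A i k * re_entry B k j - im_entry A i k * im_entry B k j).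
Proof.
apply/funext => y; rewrite /re_entry fct_sumE mxE Re_sum.
by apply: eq_bigr => k _; rewrite ReM.
Qed.

Lemma im_entryM : im_entry (fun y => A y *m B y) i j =
  \sum_(k < N) (re_entry A i k * im_entry B k j + im_entry A i k * re_entry B k j).
Proof.
apply/funext => y; rewrite /im_entry fct_sumE mxE Im_sum.
by apply: eq_bigr => k _; rewrite ImM.
Qed.
End entries.

Section mx_derivatives.
Variables (R : realType) (N : nat) (x v : R * R).
Implicit Types (A B : R * R -> 'M[R[i]]_N) (X Y : 'M[R[i]]_N).

(** Differentiability along v with its value, in the style of is_derive, so
    that the rules of calculus can be chained. *)
Definition mx_is_derive A (X : 'M[R[i]]_N) := forall i j,
  is_derive x v (re_entry A i j) (complex.Re (X i j)) /\
  is_derive x v (im_entry A i j) (complex.Im (X i j)).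

Lemma mx_differentiable_is_derive A :
  mx_differentiable A x -> mx_is_derive A (mx_derive A v x).
Proof.
move=> dA i j; have [dre dim] := dA i j; rewrite mxE /=.
by split; apply: DeriveDef => //; exact: diff_derivable.
Qed.

Lemma mx_is_deriveE A X : mx_is_derive A X -> mx_derive A v x = X.
Proof.
move=> dA; apply/matrixP => i j; have [dre dim] := dA i j; rewrite mxE.
by rewrite (is_derive_val dre) (is_derive_val dim); case: (X i j).
Qed.

Lemma mx_is_deriveD A B X Y : mx_is_derive A X -> mx_is_derive B Y ->
  mx_is_derive (fun y => A y + B y) (X + Y).
Proof.
move=> dA dB i j; have [dAr dAi] := dA i j; have [dBr dBi] := dB i j.
by rewrite mxE ReD ImD re_entryD im_entryD; split; exact: is_deriveD.
Qed.

Lemma mx_is_deriveZ (c : R[i]) A X : mx_is_derive A X ->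
  mx_is_derive (fun y => c *: A y) (c *: X).
Proof.
move=> dA i j; have [dr di] := dA i j.
rewrite mxE ReM ImM re_entryZ im_entryZ.
by split; [exact: is_deriveB|exact: is_deriveD].
Qed.

Lemma mx_is_deriveM A B X Y : mx_is_derive A X -> mx_is_derive B Y ->
  mx_is_derive (fun y => A y *m B y) (X *m B x + A x *m Y).
Proof.
move=> dA dB i j.
have -> : (X *m B x + A x *m Y) i j = \sum_(k < N) (X i k * B x k j + A x i k * Y k j).
  by rewrite 3!mxE -big_split.
have dre k : is_derive x v
    (re_entry A i k * re_entry B k j - im_entry A i k * im_entry B k j)
    (complex.Re (X i k * B x k j + A x i k * Y k j)).
  have [dAr dAi] := dA i k; have [dBr dBi] := dB k j.
  apply: (is_derive_eq (is_deriveB (is_derive_mulr dAr dBr) (is_derive_mulr dAi dBi))).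
  by rewrite ReD !ReM /re_entry /im_entry; ring.
have dim k : is_derive x v
    (re_entry A i k * im_entry B k j + im_entry A i k * re_entry B k j)
    (complex.Im (X i k * B x k j + A x i k * Y k j)).
  have [dAr dAi] := dA i k; have [dBr dBi] := dB k j.
  apply: (is_derive_eq (is_deriveD (is_derive_mulr dAr dBi) (is_derive_mulr dAi dBr))).
  by rewrite ImD !ImM /re_entry /im_entry; ring.
rewrite re_entryM im_entryM Re_sum Im_sum.
by split; [exact: (is_derive_sum dre)|exact: (is_derive_sum dim)].
Qed.

Lemma mx_is_derive_tr A X : mx_is_derive A X ->
  is_derive x v (fun y => complex.Re (\tr (A y))) (complex.Re (\tr X)) /\
  is_derive x v (fun y => complex.Im (\tr (A y))) (complex.Im (\tr X)).
Proof.
move=> dA; rewrite /mxtrace Re_sum Im_sum; split.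
  rewrite (_ : (fun y => _) = \sum_(i < N) re_entry A i i).
    by apply: is_derive_sum => i; case: (dA i i).
  by apply/funext => y; rewrite fct_sumE Re_sum.
rewrite (_ : (fun y => _) = \sum_(i < N) im_entry A i i).
  by apply: is_derive_sum => i; case: (dA i i).
by apply/funext => y; rewrite fct_sumE Im_sum.
Qed.

End mx_derivatives.

(** A class S of functions is here a linear subspace closed under products; the
    functions of class C^k and the functions that tend to 0 at infinity are
    the two examples below. *)
Section entrywise_closure.
Variables (R : realType) (N : nat) (S : (R * R -> R) -> Prop).
Hypotheses (S0 : S 0) (SD : forall f g, S f -> S g -> S (f + g)).
Hypothesis SZ : forall (c : R) f, S f -> S (c *: f).
Hypothesis SM : forall f g, S f -> S g -> S (f * g).
Implicit Types A B : R * R -> 'M[R[i]]_N.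

Definition entrywise A := forall i j, S (re_entry A i j) /\ S (im_entry A i j).

Let SB f g : S f -> S g -> S (f - g).
Proof. by move=> Sf Sg; rewrite -[- g]scaleN1r; apply: SD => //; exact: SZ. Qed.

Let S_sum (F : 'I_N -> R * R -> R) : (forall i, S (F i)) -> S (\sum_(i < N) F i).
Proof. by move=> SF; apply: big_ind. Qed.

Lemma entrywiseD A B : entrywise A -> entrywise B ->
  entrywise (fun y => A y + B y).
Proof.
move=> SA SB_ i j; have [Ar Ai] := SA i j; have [Br Bi] := SB_ i j.
by rewrite re_entryD im_entryD; split; exact: SD.
Qed.

Lemma entrywiseZ (c : R[i]) A : entrywise A -> entrywise (fun y => c *: A y).
Proof.
move=> SA i j; have [Ar Ai] := SA i j.
by rewrite re_entryZ im_entryZ; split; [apply: SB|apply: SD]; exact: SZ.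
Qed.

Lemma entrywise_tr_mul A B : entrywise A -> entrywise B ->
  S (fun y => complex.Re (\tr (A y *m B y))) /\
  S (fun y => complex.Im (\tr (A y *m B y))).
Proof.
move=> SA SB_; split.
  rewrite (_ : (fun y => _) = \sum_(i < N) re_entry (fun y => A y *m B y) i i).
    apply: S_sum => i; rewrite re_entryM; apply: S_sum => k.
    by have [? ?] := SA i k; have [? ?] := SB_ k i; apply: SB; exact: SM.
  by apply/funext => y; rewrite fct_sumE Re_sum.
rewrite (_ : (fun y => _) = \sum_(i < N) im_entry (fun y => A y *m B y) i i).
  apply: S_sum => i; rewrite im_entryM; apply: S_sum => k.
  by have [? ?] := SA i k; have [? ?] := SB_ k i; apply: SD; exact: SM.
by apply/funext => y; rewrite fct_sumE Im_sum.
Qed.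

End entrywise_closure.

Lemma mx_class_C_derive (R : realType) (N k : nat)
    (A : R * R -> 'M[R[i]]_N) (v : R * R) :
  mx_class_C k.+1 A -> mx_class_C k (mx_derive A v).
Proof.
move=> CA i j; have [[_ Dre] [_ Dim]] := CA i j.
rewrite re_entry_derive im_entry_derive.
by split; [exact: Dre|exact: Dim].
Qed.

Lemma mx_class_C_differentiable (R : realType) (N k : nat)
    (A : R * R -> 'M[R[i]]_N) (x : R * R) :
  mx_class_C k.+1 A -> mx_differentiable A x.
Proof. by move=> CA i j; have [[dr _] [di _]] := CA i j. Qed.

(** * Regularity at the point at infinity and hermitian traces *)

Local Open Scope sesquilinear_scope.

Section chart_at_infinity.
Variables (R : realType) (N : nat) (P : ext_plane R -> 'M[R[i]]_N).

Lemma chart_infty_inversion (x : R * R) : sqnorm x != 0 ->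
  chart_infty (inversion1 x, inversion2 x) = chart_finite x.
Proof.
move=> n0; rewrite /chart_infty.
have invE : inversion1 x +i* inversion2 x = (x.1 +i* x.2)^-1.
  by rewrite /inversion1 /inversion2 mulNr.
case: eqP => [[a0 b0]|_]; last first.
  rewrite -[LHS]/(Some (complex.Re (inversion1 x +i* inversion2 x)^-1,
    complex.Im (inversion1 x +i* inversion2 x)^-1)).
  by rewrite invE invrK /chart_finite /= -surjective_pairing.
exfalso; move: invE; rewrite a0 b0 => /esym/eqP; rewrite invr_eq0 eq_complex /=.
by move=> /andP[/eqP x1 /eqP x2]; move: n0; rewrite /sqnorm x1 x2 expr0n addr0 eqxx.
Qed.

(** This is where the regularity of P at the point at infinity is used. *)
Lemma mx_derive_cvg0_at_infinity v : C2_ext_plane P ->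
  entrywise (fun f => f @ @at_infinity R --> 0)
    (mx_derive (P \o @chart_finite R) v).
Proof.
move=> [_ CQ] i j; have [CQr CQi] := CQ i j.
split.
  rewrite re_entry_derive.
  apply: (@derive_cvg0_at_infinity _ _ _ v (class_CW CQr)) => x n0.
  by rewrite /re_entry /= chart_infty_inversion.
rewrite im_entry_derive.
apply: (@derive_cvg0_at_infinity _ _ _ v (class_CW CQi)) => x n0.
by rewrite /im_entry /= chart_infty_inversion.
Qed.
End chart_at_infinity.

Section hermitian_trace.
Variables (R : realType) (N : nat).
Implicit Types X Y : 'M[R[i]]_N.

Lemma mxtrace_hermitian_real X Y : X ^t* = X -> Y ^t* = Y ->
  complex.Im (\tr (X *m Y)) = 0.
Proof.
move=> hX hY.
have conjE (Z : 'M[R[i]]_N) i j : Z ^t* = Z -> Num.conj (Z i j) = Z j i.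
  by move=> hZ; rewrite -{2}hZ !mxE.
have trC : \tr (X *m Y) = Num.conj (\tr (X *m Y)).
  rewrite [LHS]mxtrace_mulC /mxtrace rmorph_sum; apply: eq_bigr => i _.
  rewrite !mxE rmorph_sum; apply: eq_bigr => k _.
  by rewrite rmorphM /= !conjE // mulrC.
by move: trC; case: (\tr _) => a b [] /eqP; rewrite -addr_eq0 -mulr2n mulrn_eq0 /= => /eqP.
Qed.

Lemma mxtrace_hermitian_sqr_ge0 X : X ^t* = X -> 0 <= \tr (X *m X).
Proof.
move=> hX; apply: sumr_ge0 => i _; rewrite mxE; apply: sumr_ge0 => k _.
by rewrite -{2}hX !mxE mulcJ_ge0.
Qed.
End hermitian_trace.

(** * The Hopf differential *)

Section projector_derivatives.
Variables (R : realType) (N : nat) (A : R * R -> 'M[R[i]]_N).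
Hypothesis A_diff : forall x, mx_differentiable A x.
Hypothesis A_proj : forall x, rank1_projector (A x).

(** Differentiate A A = A. *)
Lemma derive_projector_tangent v x :
  mx_derive A v x *m A x + A x *m mx_derive A v x = mx_derive A v x.
Proof.
have dA := mx_differentiable_is_derive v (A_diff x).
have := mx_is_deriveE (mx_is_deriveM dA dA).
rewrite (_ : (fun y => A y *m A y) = A); first by move=> <-.
by apply/funext => y; case: (A_proj y).
Qed.

Lemma derive_hermitian v x : (mx_derive A v x) ^t* = mx_derive A v x.
Proof.
apply/matrixP => i j; rewrite !mxE.
have conjA y : A y j i = (A y i j)^*.
  by case: (A_proj y) => _ hA _; rewrite -{1}hA !mxE.
have -> : re_entry A j i = re_entry A i j.
  by apply/funext => y; rewrite /re_entry conjA; case: (A y i j).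
have -> : im_entry A j i = - im_entry A i j.
  by apply/funext => y; rewrite /im_entry conjA /GRing.opp /=; case: (A y i j).
rewrite deriveN; first by rewrite conjCE /= opprK.
by have [_ ?] := A_diff x i j; exact: diff_derivable.
Qed.
End projector_derivatives.

(** The coefficient of the Hopf differential. For a hermitian A it vanishes at
    x exactly when the two partial derivatives of A at x are orthogonal and of
    the same length for the trace form. *)
Definition hopf (R : realType) (N : nat) (A : R * R -> 'M[R[i]]_N)
    (x : R * R) : R[i] :=
  \tr (dplus A x *m dplus A x).

Section hopf_differential.
Variables (R : realType) (N : nat) (A : R * R -> 'M[R[i]]_N).
Hypothesis A_C2 : mx_class_C 2 A.

Lemma mx_derive_symmetric v w x :
  mx_derive (mx_derive A v) w x = mx_derive (mx_derive A w) v x.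
Proof.
apply/matrixP => i j; rewrite [LHS]mxE [RHS]mxE.
have reE u u' : 'D_u' (re_entry (mx_derive A u) i j) x = 'D_u' ('D_u (re_entry A i j)) x.
  by rewrite re_entry_derive.
have imE u u' : 'D_u' (im_entry (mx_derive A u) i j) x = 'D_u' ('D_u (im_entry A i j)) x.
  by rewrite im_entry_derive.
have [dr di] := A_C2 i j.
have sym (f : R * R -> R) : class_C 2 f -> 'D_w ('D_v f) x = 'D_v ('D_w f) x.
  move=> [df Df]; have [dv Dv] := Df v; have [dw Dw] := Df w.
  by apply: derive_symmetric => //; [exact: (Dv w)|exact: (Dw v)].
have re_sym := etrans (reE v w) (etrans (sym _ dr) (esym (reE w v))).
have im_sym := etrans (imE v w) (etrans (sym _ di) (esym (imE w v))).
exact: (congr2 (@Complex R) re_sym im_sym).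
Qed.

Lemma dplusE : dplus A = fun y => 2^-1 *: (d1 A y + (- 'i%C) *: d2 A y).
Proof. by apply/funext => y; rewrite /dplus scaleNr. Qed.

Lemma dminusE : dminus A = fun y => 2^-1 *: (d1 A y + 'i%C *: d2 A y).
Proof. by []. Qed.

Lemma mx_is_derive_d v w x :
  mx_is_derive x v (mx_derive A w) (mx_derive (mx_derive A w) v x).
Proof.
apply: mx_differentiable_is_derive; apply: mx_class_C_differentiable.
exact: mx_class_C_derive.
Qed.

Lemma mx_is_derive_dplus v x : mx_is_derive x v (dplus A)
  (2^-1 *: (mx_derive (d1 A) v x + (- 'i%C) *: mx_derive (d2 A) v x)).
Proof.
rewrite dplusE; apply: mx_is_deriveZ; apply: mx_is_deriveD.
  exact: mx_is_derive_d.
by apply: mx_is_deriveZ; exact: mx_is_derive_d.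
Qed.

Lemma mx_is_derive_dminus v x : mx_is_derive x v (dminus A)
  (2^-1 *: (mx_derive (d1 A) v x + 'i%C *: mx_derive (d2 A) v x)).
Proof.
rewrite dminusE; apply: mx_is_deriveZ; apply: mx_is_deriveD.
  exact: mx_is_derive_d.
by apply: mx_is_deriveZ; exact: mx_is_derive_d.
Qed.

Lemma dminus_dplus x : dminus (dplus A) x = dplus (dminus A) x.
Proof.
rewrite /dminus /dplus -/(dminus A) -/(dplus A).
rewrite /d1 /d2 !(mx_is_deriveE (mx_is_derive_dplus _ x)).
rewrite !(mx_is_deriveE (mx_is_derive_dminus _ x)).
rewrite /d1 /d2 (mx_derive_symmetric (1, 0) (0, 1)).
set a := mx_derive _ _ _; set b := mx_derive _ _ _; set c := mx_derive _ _ _.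
clearbody a b c.
apply/matrixP => i j; rewrite !mxE; ring.
Qed.

Hypothesis A_proj : forall x, rank1_projector (A x).
Hypothesis A_EL : euler_lagrange A.

Let A_diff x : mx_differentiable A x.
Proof. exact: mx_class_C_differentiable A_C2. Qed.

Lemma dplus_tangent x : dplus A x *m A x + A x *m dplus A x = dplus A x.
Proof.
have t1 := derive_projector_tangent A_diff A_proj (1, 0) x.
have t2 := derive_projector_tangent A_diff A_proj (0, 1) x.
rewrite dplusE -scalemxAl -scalemxAr -scalerDr /d1 /d2 mulmxDl mulmxDr.
by rewrite -!scalemxAl -!scalemxAr addrACA -scalerDr t1 t2.
Qed.

Lemma is_derive_hopf v x :
  is_derive x v (fun y => complex.Re (hopf A y))
    (complex.Re (2 * \tr (mx_derive (dplus A) v x *m dplus A x))) /\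
  is_derive x v (fun y => complex.Im (hopf A y))
    (complex.Im (2 * \tr (mx_derive (dplus A) v x *m dplus A x))).
Proof.
have dP : mx_is_derive x v (dplus A) (mx_derive (dplus A) v x).
  by rewrite (mx_is_deriveE (mx_is_derive_dplus v x)); exact: mx_is_derive_dplus.
have := mx_is_derive_tr (mx_is_deriveM dP dP).
by rewrite !(mulr_natl _ 2) mxtraceD [X in _ + X]mxtrace_mulC -mulr2n.
Qed.

(** Up to a factor, the left-hand side is the trace of dplus A times
    dminus (dplus A); the first factor is tangent at the projector and the
    second commutes with it, by the Euler-Lagrange equations. *)
Lemma hopf_holomorphic x :
  \tr (mx_derive (dplus A) (1, 0) x *m dplus A x) +
  'i%C * \tr (mx_derive (dplus A) (0, 1) x *m dplus A x) = 0.
Proof.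
have [PP _ _] := A_proj x.
have DP : dminus (dplus A) x *m A x = A x *m dminus (dplus A) x.
  by rewrite dminus_dplus; apply/eqP; rewrite -subr_eq0; apply/eqP; exact: A_EL.
have := mxtrace_commuting_tangent PP DP (dplus_tangent x).
rewrite /dminus -scalemxAl mxtraceZ mulmxDl mxtraceD -scalemxAl mxtraceZ.
move/eqP; rewrite mulf_eq0 invr_eq0 pnatr_eq0 /= => /eqP; exact.
Qed.

Lemma hopf_cauchy_riemann x :
  'D_(1, 0) (fun y => complex.Re (hopf A y)) x =
    'D_(0, 1) (fun y => complex.Im (hopf A y)) x /\
  'D_(0, 1) (fun y => complex.Re (hopf A y)) x =
    - 'D_(1, 0) (fun y => complex.Im (hopf A y)) x.
Proof.
have CR (T1 T2 : R[i]) : T1 + 'i%C * T2 = 0 ->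
    complex.Re (2 * T1) = complex.Im (2 * T2) /\
    complex.Re (2 * T2) = - complex.Im (2 * T1).
  move=> /eqP; rewrite eq_complex ReD ImD !ReM !ImM.
  move: T1 T2 => [a b] [c d] /= /andP[/eqP h1 /eqP h2].
  by split; lra.
have [r1 i1] := is_derive_hopf (1, 0) x; have [r2 i2] := is_derive_hopf (0, 1) x.
have [c1 c2] := CR _ _ (hopf_holomorphic x).
have E1 := is_derive_val r1; have E2 := is_derive_val r2.
have E3 := is_derive_val i1; have E4 := is_derive_val i2.
split; first exact: (etrans E1 (etrans c1 (esym E4))).
exact: (etrans E2 (etrans c2 (congr1 -%R (esym E3)))).
Qed.

Lemma hopf_class_C1 : class_C 1 (fun y => complex.Re (hopf A y)) /\
  class_C 1 (fun y => complex.Im (hopf A y)).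
Proof.
have cl : entrywise (class_C 1) (dplus A).
  rewrite dplusE; apply: entrywiseZ; [exact: class_CD|exact: class_CZ|].
  apply: entrywiseD; first exact: class_CD; first exact: mx_class_C_derive.
  by apply: entrywiseZ; [exact: class_CD|exact: class_CZ|exact: mx_class_C_derive].
exact: (entrywise_tr_mul (class_C_cst 1 0) (@class_CD _ 1) (@class_CZ _ 1)
  (@class_CM _ 1) cl cl).
Qed.

Hypothesis A_decay : forall v,
  entrywise (fun f => f @ @at_infinity R --> 0) (mx_derive A v).

Lemma hopf_cvg0_at_infinity :
  complex.Re (hopf A y) @[y --> @at_infinity R] --> 0 /\
  complex.Im (hopf A y) @[y --> @at_infinity R] --> 0.
Proof.
pose S (f : R * R -> R) := f @ @at_infinity R --> 0.
have S0 : S 0 by exact: cvg_cst.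
have SD f g : S f -> S g -> S (f + g).
  by move=> Sf Sg; rewrite /S -[X in _ --> X](addr0 0); exact: cvgD.
have SZ c f : S f -> S (c *: f).
  by move=> Sf; rewrite /S -[X in _ --> X](mulr0 c); apply: cvgM => //; exact: cvg_cst.
have SM f g : S f -> S g -> S (f * g).
  by move=> Sf Sg; rewrite /S -[X in _ --> X](mulr0 0); exact: cvgM.
have dS : entrywise S (dplus A).
  rewrite dplusE.
  exact: (entrywiseZ SD SZ _
    (entrywiseD SD (A_decay _) (entrywiseZ SD SZ _ (A_decay _)))).
exact: (entrywise_tr_mul S0 SD SZ SM dS dS).
Qed.

(** An entire function that tends to 0 at infinity is zero. *)
Lemma hopf_eq0 x : hopf A x = 0.
Proof.
have [Cr Ci] := hopf_class_C1; have [r0 i0] := hopf_cvg0_at_infinity.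
have := decaying_cauchy_riemann_eq0 Cr Ci (fun x => (hopf_cauchy_riemann x).1)
  (fun x => (hopf_cauchy_riemann x).2) r0 i0 x.
by case: (hopf A x).
Qed.

End hopf_differential.

(** * The associated surface *)

Section surface.
Variables (R : realType) (N : nat) (A F : R * R -> 'M[R[i]]_N).
Hypothesis A_F : associated_surface A F.

Lemma commutator_dplus x : commutator (dplus A x) (A x) =
  2^-1 *: (commutator (d1 A x) (A x) - 'i%C *: commutator (d2 A x) (A x)).
Proof.
rewrite /commutator /dplus -scalemxAl -scalemxAr -scalerBr mulmxBl mulmxBr.
rewrite -scalemxAl -scalemxAr.
move: (_ *m A x) (A x *m _) (_ *m A x) (A x *m _) => X1 X2 X3 X4.
by apply/matrixP => i j; rewrite !mxE; ring.
Qed.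

Lemma commutator_dminus x : commutator (dminus A x) (A x) =
  2^-1 *: (commutator (d1 A x) (A x) + 'i%C *: commutator (d2 A x) (A x)).
Proof.
rewrite /commutator /dminus -scalemxAl -scalemxAr -scalerBr mulmxDl mulmxDr.
by rewrite -scalemxAl -scalemxAr opprD addrACA -scalerBr.
Qed.

Lemma d1_surface x : d1 F x = - commutator (d2 A x) (A x).
Proof.
have [_ _ dF] := A_F; rewrite [LHS]dF /surface_form commutator_dplus commutator_dminus.
move: (commutator (d1 A x) _) (commutator (d2 A x) _) => X Y; clear.
rewrite /= oppr0 -[1 +i* 0]/(1 : R[i]) !scale1r.
apply/matrixP => i j; rewrite !mxE; apply: subr0_eq.
transitivity (('i%C ^+ 2 + 1) * Y i j); first by field.
by rewrite sqr_i addNr mul0r.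
Qed.

Lemma d2_surface x : d2 F x = commutator (d1 A x) (A x).
Proof.
have [_ _ dF] := A_F; rewrite [LHS]dF /surface_form commutator_dplus commutator_dminus.
move: (commutator (d1 A x) _) (commutator (d2 A x) _) => X Y; clear.
have conj_i : 0 -i* 1 = - 'i%C :> R[i] by rewrite /GRing.opp /= oppr0.
rewrite /= conj_i; apply/matrixP => i j; rewrite !mxE; apply: subr0_eq.
transitivity (- ('i%C ^+ 2 + 1) * X i j); first by field.
by rewrite sqr_i addNr oppr0 mul0r.
Qed.

End surface.

Section conformal.
Variables (R : realType) (N : nat) (A F : R * R -> 'M[R[i]]_N).
Hypothesis A_diff : forall x, mx_differentiable A x.
Hypothesis A_proj : forall x, rank1_projector (A x).

Lemma lagrangianE x : lagrangian A x =
  4^-1 * (\tr (d1 A x *m d1 A x) + \tr (d2 A x *m d2 A x)).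
Proof.
rewrite /lagrangian /dplus /dminus.
move: (d1 A x) (d2 A x) => X Y.
rewrite -!scalemxAl -!scalemxAr !mxtraceZ mulmxBl !mulmxDr -!scalemxAl -!scalemxAr.
rewrite raddfB /= !mxtraceD !mxtraceZ (mxtrace_mulC Y X) mulrA mulrA -expr2 -expr2 sqr_i.
move: (\tr (X *m X)) (\tr (X *m Y)) (\tr (Y *m Y)) => a b c.
by field.
Qed.

Lemma hopfE x : hopf A x = 4^-1 * (\tr (d1 A x *m d1 A x) - \tr (d2 A x *m d2 A x)
   - 2 * 'i%C * \tr (d1 A x *m d2 A x)).
Proof.
have lin (U V W Z : 'M[R[i]]_N) (c : R[i]) :
    \tr (U - c *: V - (c *: W - c *: (c *: Z))) =
    \tr U - c * \tr V - (c * \tr W - c * (c * \tr Z)).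
  by rewrite raddfB /= raddfB /= raddfB /= !mxtraceZ.
rewrite /hopf /dplus.
move: (d1 A x) (d2 A x) => X Y.
rewrite -!scalemxAl -!scalemxAr !mxtraceZ mulmxBl !mulmxBr -!scalemxAl -!scalemxAr.
rewrite lin (mxtrace_mulC Y X).
move: (\tr (X *m X)) (\tr (X *m Y)) (\tr (Y *m Y)) => a b c.
apply: subr0_eq; transitivity (4^-1 * (('i%C ^+ 2 + 1) * c)); first by field.
by rewrite sqr_i addNr mul0r mulr0.
Qed.

(** The three traces are real because the derivatives of A are hermitian, so
    the real and imaginary parts of the Hopf differential separate them. *)
Lemma hopf_eq0_conformal x : hopf A x = 0 ->
  \tr (d1 A x *m d1 A x) = \tr (d2 A x *m d2 A x) /\ \tr (d1 A x *m d2 A x) = 0.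
Proof.
have h1 : (d1 A x)^t* = d1 A x := derive_hermitian A_diff A_proj _ x.
have h2 : (d2 A x)^t* = d2 A x := derive_hermitian A_diff A_proj _ x.
move: h1 h2; rewrite hopfE; move: (d1 A x) (d2 A x) => X Y hX hY.
have := mxtrace_hermitian_real hX hX; have := mxtrace_hermitian_real hY hY.
have := mxtrace_hermitian_real hX hY.
move: (\tr (X *m Y)) (\tr (Y *m Y)) (\tr (X *m X)) => [c c'] [b b'] [a a'] /= -> -> ->.
move=> /eqP; rewrite mulf_eq0 invr_eq0 pnatr_eq0 /= => /eqP H.
have := congr1 (@complex.Re R) H; have := congr1 (@complex.Im R) H.
rewrite /= => {H} H1 H2. split; congr Complex; lra.
Qed.

Lemma lagrangian_ge0 x : 0 <= lagrangian A x.
Proof.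
rewrite lagrangianE mulr_ge0 ?invr_ge0 // addr_ge0 // mxtrace_hermitian_sqr_ge0 //.
  exact: derive_hermitian.
exact: derive_hermitian.
Qed.

Hypothesis A_F : associated_surface A F.

(** The partial derivatives of F are, up to sign and order, the brackets of
    those of A with A, and these brackets are isometric up to a factor for the
    trace form. *)
Lemma first_fundamental_formE x : hopf A x = 0 ->
  first_fundamental_form F x = (lagrangian A x)%:M.
Proof.
move=> /hopf_eq0_conformal[e11 e12].
have [PP _ _] := A_proj x.
have t1 : d1 A x *m A x + A x *m d1 A x = d1 A x :=
  derive_projector_tangent A_diff A_proj _ x.
have t2 : d2 A x *m A x + A x *m d2 A x = d2 A x :=
  derive_projector_tangent A_diff A_proj _ x.
have bracket X Y : X *m A x + A x *m X = X -> Y *m A x + A x *m Y = Y ->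
    \tr (commutator X (A x) *m commutator Y (A x)) = - \tr (X *m Y).
  exact: mxtrace_tangent_brackets.
have trN (U : 'M[R[i]]_N) : \tr (- U) = - \tr U by exact: raddfN.
have e21 : \tr (d2 A x *m d1 A x) = 0 by rewrite mxtrace_mulC.
have L : lagrangian A x = 2^-1 * \tr (d2 A x *m d2 A x).
  by rewrite lagrangianE e11; field.
apply/matrixP => k l; rewrite [LHS]mxE [RHS]mxE L /su_inner.
case: k l => [[|[|//]] ?] [[|[|//]] ?]; rewrite /= ?mulr1n ?mulr0n.
- by rewrite (d1_surface A_F) mulmxN mulNmx opprK bracket // mulrNN.
- by rewrite (d1_surface A_F) (d2_surface A_F) mulNmx trN bracket // e21 !oppr0 mulr0.
- by rewrite (d1_surface A_F) (d2_surface A_F) mulmxN trN bracket // e12 !oppr0 mulr0.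
- by rewrite (d2_surface A_F) bracket // e11 mulrNN.
Qed.
End conformal.


Local Close Scope sesquilinear_scope.

Theorem theorem9 (R : realType) (N : nat) (P : ext_plane R -> 'M[R[i]]_N)
    (P_C2 : C2_ext_plane P)
    (P_proj : forall z : ext_plane R, rank1_projector (P z))
    (P_EL : euler_lagrange (P \o @chart_finite R))
    (P_action : (action (P \o @chart_finite R) < +oo)%E)
    (F : R * R -> 'M[R[i]]_N)
    (P_F : associated_surface (P \o @chart_finite R) F) :
  [/\ exists2 c : R, 0 < c &
        forall x : R * R, first_fundamental_form F x =
          (c%:C * lagrangian (P \o @chart_finite R) x)%:M,
      area F = action (P \o @chart_finite R) &
      (area F < +oo)%E].
Proof.
have [A_C2 _] := P_C2.
have A_proj x : rank1_projector ((P \o @chart_finite R) x) by exact: P_proj.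
have A_decay v := mx_derive_cvg0_at_infinity v P_C2.
have A_diff x : mx_differentiable (P \o @chart_finite R) x.
  exact: mx_class_C_differentiable A_C2.
have fff x : first_fundamental_form F x = (lagrangian (P \o @chart_finite R) x)%:M.
  by apply: first_fundamental_formE => //; exact: hopf_eq0.
have area_action : area F = action (P \o @chart_finite R).
  rewrite /area /action; apply: eq_integral => x _; rewrite fff det_scalar.
  have := lagrangian_ge0 A_diff A_proj x.
  rewrite expr2 ReM; case: (lagrangian _ x) => a b.
  rewrite lecE => /andP[/eqP /= -> a_ge0].
  by rewrite mul0r subr0 -expr2 sqrtr_sqr ger0_norm.
split => //; last by rewrite area_action.
by exists 1 => // x; rewrite mul1r.
Qed.
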